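(* The algorithm SIPP-IP is complete: for every problem instance $(G, w, \mathrm{vel}, SI, v_{start}, t_{start}, v_{goal})$ and every admissible and consistent heuristic $h$, if there exists a feasible collision-free trajectory from $v_{start}$ (starting at time $t_{start}$) to $v_{goal}$, then SIPP-IP terminates after finitely many iterations and returns a feasible collision-free trajectory from $v_{start}$ (starting at time $t_{start}$) to $v_{goal}$.
   Context: **Problem.** Time is discrete, $T=\{0,1,2,\dots\}$. An instance consists of: a directed graph $G=(V,E)$ in which each vertex has finitely many outgoing edges and each edge $e=(v,u)$ has $u\neq v$; a duration $w(e)\in\mathbb{N}$, $w(e)\ge 1$, for each edge; a velocity $\mathrm{vel}(v)\ge 0$ for each vertex (part of the agent's configuration; the agent may wait only at vertices with $\mathrm{vel}(v)=0$); for each vertex $v$ a finite sequence $SI(v)$ of pairwise disjoint intervals of time steps (safe intervals; an interval is $[a,b]=\{t\in T: a\le t\le b\}$, with $b=\infty$ allowed), any two of which are separated by at least one time step not in any of them; for each edge $e$ a finite sequence $SI(e)$ of pairwise disjoint intervals; vertices $v_{start},v_{goal}$; and a start time $t_{start}\in T$ lying in a safe interval of $v_{start}$. Write $t\in SI(x)$ if $t$ lies in some interval of $SI(x)$. A transition $(e,t)$ with $e=(v,u)$ is collision-free if $t\in SI(e)$ and $t+w(e)\in SI(u)$. A trajectory is a finite sequence $\pi=(e_1,t_1),\dots,(e_L,t_L)$ with $t_i\in T$ the starting time of the move $e_i$. It is feasible from $(v_{start},t_{start})$ to $v_{goal}$ if: the source of $e_1$ is $v_{start}$ and the target of $e_L$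 is $v_{goal}$; the target of $e_i$ equals the source of $e_{i+1}$; $t_1\ge t_{start}$ and $t_{i+1}\ge t_i+w(e_i)$; and whenever one of these inequalities is strict (i.e. the agent waits), the vertex at which the wait takes place (the source of $e_1$, resp. of $e_{i+1}$) has velocity $0$. It is collision-free if every transition $(e_i,t_i)$ is collision-free and whenever the agent waits at a vertex $v$ from time $a$ to time $b$, all time steps $a,a+1,\dots,b$ lie in $SI(v)$. Its cost is $t_L+w(e_L)$. If $v_{start}=v_{goal}$ the empty trajectory is allowed, with cost $t_{start}$. **Heuristic.** $h:V\to[0,\infty)$ with $h(v_{goal})=0$; admissible: $h(v)$ never exceeds the minimal total duration needed to travel from $v$ to $v_{goal}$; consistent: $h(v)\le w(e)+h(u)$ for every edge $e=(v,u)$. **SIPP-IP.** A search node is a pair $n=(v,[t_l,t_u])$ where $[t_l,t_u]$ is an interval ($t_u=\infty$ allowed) contained in one safe interval of $v$. Two nodes are identical iff both the vertex and the interval coincide. Its $f$-value is $f(n)=t_l+h(v)$. *Projection.* For a node $n=(v,[t_l,t_u])$ and an edge $e=(v,v')$, $\mathrm{projectIntervals}(n,e)$ returns a finite set of pairwise disjoint intervals, each contained in a safe interval of $v'$, whose union is exactly $\{t+w(e): t\in[t_l,t_u],\ (e,t)\text{ is collision-free}\}$. *Successors.* For each outgoing edge $e=(v,v')$ of $v$, compute $\mathrm{projectIntervals}(n,e)$; if $\mathrm{vel}(v')=0$, replace the upper bound of each resulting interval by the upper bound of the safe interval of $v'$ containing it; each resulting interval $ti$ gives a successor $(v',ti)$.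 *Main loop.* The start node is $n_{start}=(v_{start},[t_{start},t_{start}])$ if $\mathrm{vel}(v_{start})\ne 0$, and otherwise $(v_{start},[t_{start},b])$ with $b$ the upper bound of the safe interval of $v_{start}$ containing $t_{start}$. Initially OPEN $=\{n_{start}\}$, CLOSED $=\emptyset$. While OPEN is nonempty: move a node $n$ of minimal $f$-value (ties broken arbitrarily) from OPEN to CLOSED; if the vertex of $n$ is $v_{goal}$, return the trajectory reconstructed from $n$; otherwise generate all successors of $n$, and insert into OPEN each successor that is not already in OPEN or CLOSED, recording $n$ as its parent and the edge used. If OPEN becomes empty, report failure. *Reconstruction.* Start with $n$ the extracted goal node and $t=t_l(n)$. While $n\ne n_{start}$: let $e$ be the recorded edge from the parent of $n$ to $n$; if $n$'s vertex has velocity $0$, prepend $(e,t_l(n)-w(e))$ to $\pi$ and set $t:=t_l(n)-w(e)$; otherwise prepend $(e,t-w(e))$ and set $t:=t-w(e)$; then set $n$ to its parent. If the final $t$ exceeds $t_{start}$, the agent waits at $v_{start}$ for $t-t_{start}$ steps. *)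

(* Defs.v *)
From Stdlib Require Export Relation_Operators.
From mathcomp Require Export all_boot all_order all_algebra.
From mathcomp Require Export reals.

Set Implicit Arguments.
Unset Strict Implicit.
Unset Printing Implicit Defensive.

Import Order.TTheory GRing.Theory Num.Theory.

(* [(a, Some b)] is {a, ..., b} and [(a, None)] is {a, a + 1, ...}.  Intervals
   are meant to be nonempty; this is enforced by [tint_wf] where they arise. *)
Definition tint : Type := (nat * option nat)%type.

Definition tint_wf (I : tint) : bool :=
  if I.2 is Some b then I.1 <= b else true.

Definition in_tint (t : nat) (I : tint) : bool :=
  (I.1 <= t) && (if I.2 is Some b then t <= b else true).

(* For nonempty [I], this is inclusion of the sets of time steps. *)
Definition tint_sub (I J : tint) : bool :=
  (J.1 <= I.1) &&
  match I.2, J.2 with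
  | _, None => true
  | None, Some _ => false
  | Some x, Some y => x <= y
  end.

Definition in_tints (t : nat) (s : seq tint) : bool := has (in_tint t) s.

(* Positions, not values, are compared: an interval listed twice is not
   disjoint from itself. *)
Definition for_distinct_entries (P : tint -> tint -> Prop) (s : seq tint) : Prop :=
  forall i j, i < size s -> j < size s -> i != j ->
    P (nth (0, None) s i) (nth (0, None) s j).

Definition tint_disjoint (I J : tint) : Prop :=
  forall t, ~ (in_tint t I /\ in_tint t J).

Definition pairwise_disjoint (s : seq tint) : Prop :=
  for_distinct_entries tint_disjoint s.

Definition separated_in (s : seq tint) (I J : tint) : Prop :=
  exists t, ~~ in_tints t s /\
    ((forall a b, in_tint a I -> in_tint b J -> a < t < b) \/
     (forall a b, in_tint a I -> in_tint b J -> b < t < a)).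

Section Sipp.

Variables (R : realType) (V : eqType).

Definition edge : Type := (V * V)%type.

(* The edges leaving [v] are the pairs [(v, u)] with [u \in adj v]; adjacency
   lists encode that every vertex has finitely many outgoing edges.  [dur] and
   [SIe] are only relevant on edges. *)
Record instance := Instance {
  adj : V -> seq V;
  dur : edge -> nat;
  vel : V -> R;
  SIv : V -> seq tint;
  SIe : edge -> seq tint;
  vstart : V;
  vgoal : V;
  tstart : nat
}.

Definition is_edge (P : instance) (e : edge) : bool := grel (adj P) e.1 e.2.

Record valid_instance (P : instance) : Prop := ValidInstance {
  edge_neq : forall e, is_edge P e -> e.2 != e.1;
  dur_ge1 : forall e, is_edge P e -> 1 <= dur P e;
  vel_ge0 : forall v, (0 <= vel P v)%R;
  SIv_wf : forall v, all tint_wf (SIv P v);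
  SIv_disjoint : forall v, pairwise_disjoint (SIv P v);
  SIv_separated : forall v,
    for_distinct_entries (separated_in (SIv P v)) (SIv P v);
  SIe_wf : forall e, is_edge P e -> all tint_wf (SIe P e);
  SIe_disjoint : forall e, is_edge P e -> pairwise_disjoint (SIe P e);
  tstart_safe : in_tints (tstart P) (SIv P (vstart P))
}.

Definition transition_free (P : instance) (e : edge) (t : nat) : bool :=
  in_tints t (SIe P e) && in_tints (t + dur P e) (SIv P e.2).

Definition trajectory : Type := seq (edge * nat).

(* The agent has been at [v] since time [t]; waits are implicit, being the gaps
   between [t] and the start of the next move. *)
Fixpoint feasible (P : instance) (v : V) (t : nat) (g : V) (pi : trajectory) : Prop :=
  match pi with
  | [::] => v = g
  | (e, s) :: pi' =>
      [/\ is_edge P e, e.1 = v, t <= s, t < s -> vel P v = 0%R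
        & feasible P e.2 (s + dur P e) g pi']
  end.

Fixpoint collision_free (P : instance) (v : V) (t : nat) (pi : trajectory) : Prop :=
  match pi with
  | [::] => True
  | (e, s) :: pi' =>
      [/\ t < s -> forall x, t <= x <= s -> in_tints x (SIv P v),
          transition_free P e s
        & collision_free P e.2 (s + dur P e) pi']
  end.

Definition solution (P : instance) (pi : trajectory) : Prop :=
  feasible P (vstart P) (tstart P) (vgoal P) pi /\
  collision_free P (vstart P) (tstart P) pi.

Fixpoint path_dur (P : instance) (v : V) (p : seq V) : nat :=
  if p is u :: p' then dur P (v, u) + path_dur P u p' else 0.

(* Travel in the graph, irrespective of safe intervals; no [d] qualifies when
   the goal is unreachable from [v]. *)
Definition min_travel_dur (P : instance) (v : V) (d : nat) : Prop :=
  (exists p, [/\ path (grel (adj P)) v p, last v p = vgoal P & path_dur P v p = d]) /\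
  (forall p, path (grel (adj P)) v p -> last v p = vgoal P -> d <= path_dur P v p).

Definition is_heuristic (P : instance) (h : V -> R) : Prop :=
  (forall v, (0 <= h v)%R) /\ h (vgoal P) = 0%R.

Definition admissible (P : instance) (h : V -> R) : Prop :=
  forall v d, min_travel_dur P v d -> (h v <= d%:R)%R.

Definition consistent (P : instance) (h : V -> R) : Prop :=
  forall e, is_edge P e -> (h e.1 <= (dur P e)%:R + h e.2)%R.

Definition node : Type := (V * tint)%type.

Definition is_node (P : instance) (n : node) : Prop :=
  tint_wf n.2 /\ exists2 J, J \in SIv P n.1 & tint_sub n.2 J.

Definition node_lb (n : node) : nat := n.2.1.

Definition fvalue (h : V -> R) (n : node) : R := ((node_lb n)%:R + h n.1)%R.

(* [proj] is an arbitrary implementation of projectIntervals. *)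
Definition projection_spec (P : instance) (proj : node -> edge -> seq tint) : Prop :=
  forall n e, is_node P n -> is_edge P e -> e.1 = n.1 ->
  [/\ all tint_wf (proj n e),
      pairwise_disjoint (proj n e),
      forall I, I \in proj n e -> exists2 J, J \in SIv P e.2 & tint_sub I J
    & forall x, in_tints x (proj n e) <->
        exists t, [/\ in_tint t n.2, transition_free P e t & x = t + dur P e]].

(* Replaces the upper bound of [I] by that of the safe interval of [v]
   containing [I]. *)
Definition extend_ub (P : instance) (v : V) (I : tint) : tint :=
  (I.1, (nth I (SIv P v) (find (tint_sub I) (SIv P v))).2).

Definition arrival_tint (P : instance) (v : V) (I : tint) : tint :=
  if vel P v == 0%R then extend_ub P v I else I.

Definition start_node (P : instance) : node :=
  (vstart P, arrival_tint P (vstart P) (tstart P, Some (tstart P))).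

Definition successors (P : instance) (proj : node -> edge -> seq tint) (n : node)
    : seq (node * edge) :=
  [seq ((u, arrival_tint P u J), (n.1, u)) | u <- adj P n.1, J <- proj n (n.1, u)].

(* [parent n = Some (m, e)]: [n] was inserted as a successor of [m] along [e]. *)
Record state := State {
  OPEN : seq node;
  CLOSED : seq node;
  parent : node -> option (node * edge)
}.

Inductive config :=
| Running of state
| Returned of trajectory
| Failed.

Definition init (P : instance) : config :=
  Running (State [:: start_node P] [::] (fun=> None)).

(* Ties are allowed: any minimizer may be extracted. *)
Definition extractable (h : V -> R) (st : state) (n : node) : bool :=
  (n \in OPEN st) && all (fun m => (fvalue h n <= fvalue h m)%R) (OPEN st).

Definition close (n : node) (st : state) : state :=
  State [seq m <- OPEN st | m != n] (n :: CLOSED st) (parent st).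

Definition insert (n : node) (st : state) (s : node * edge) : state :=
  if (s.1 \in OPEN st) || (s.1 \in CLOSED st) then st
  else State (s.1 :: OPEN st) (CLOSED st)
             (fun m => if m == s.1 then Some (n, s.2) else parent st m).

Definition expand (P : instance) (proj : node -> edge -> seq tint) (n : node)
    (st : state) : state :=
  foldl (insert n) (close n st) (successors P proj n).

(* [reconstruct P par n t pi pi']: from node [n] with current time [t] and
   suffix [pi] already built, the reconstruction loop stops with [pi'].  The
   equation for [s] avoids truncated subtraction.  A wait at the start vertex is
   implicit in the starting time of the first move of [pi']. *)
Inductive reconstruct (P : instance) (par : node -> option (node * edge))
    : node -> nat -> trajectory -> trajectory -> Prop :=
| RecStop t pi : reconstruct P par (start_node P) t pi pi
| RecStep n t pi pi' m e s :
    n != start_node P ->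
    par n = Some (m, e) ->
    s + dur P e = (if vel P n.1 == 0%R then node_lb n else t) ->
    reconstruct P par m s ((e, s) :: pi) pi' ->
    reconstruct P par n t pi pi'.

(* One iteration of the main loop. *)
Inductive step (P : instance) (h : V -> R) (proj : node -> edge -> seq tint)
    : config -> config -> Prop :=
| StepFail st :
    OPEN st = [::] -> step P h proj (Running st) Failed
| StepGoal st n pi :
    extractable h st n -> n.1 = vgoal P ->
    reconstruct P (parent st) n (node_lb n) [::] pi ->
    step P h proj (Running st) (Returned pi)
| StepExpand st n :
    extractable h st n -> n.1 != vgoal P ->
    step P h proj (Running st) (Running (expand P proj n st)).

Definition infinite_run (P : instance) (h : V -> R) (proj : node -> edge -> seq tint)
    (r : nat -> config) : Prop :=
  r 0 = init P /\ forall k, step P h proj (r k) (r k.+1).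

(* [c] is the last configuration of a run that cannot be continued. *)
Definition final_config (P : instance) (h : V -> R) (proj : node -> edge -> seq tint)
    (c : config) : Prop :=
  clos_refl_trans_1n config (step P h proj) (init P) c /\
  forall c', ~ step P h proj c c'.

End Sipp.

(* Main.v *)
(* A solution reaching the goal at time [T] can be tracked through the search: as
   long as the goal has not been extracted, some node of OPEN contains the time at
   which the solution leaves (or finally occupies) that vertex, and consistency
   bounds its f-value by [T].  Hence only nodes whose lower bound is at most [T] are
   expanded, each once; lower bounds increase strictly from a node to its
   successors, so there are finitely many of them.  Conversely, walking back along
   parents, every time in the interval of a node is the arrival time of a
   collision-free transition from some time in the interval of its parent, or, at
   velocity 0, is reached by waiting inside the node's safe interval. *)

Require Import Defs.
From mathcomp Require Import zify lra.

Set Implicit Arguments.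
Unset Strict Implicit.
Unset Printing Implicit Defensive.

Import Order.TTheory GRing.Theory Num.Theory.

(** * Time intervals *)

Lemma tint_sub_in I J t : tint_sub I J -> in_tint t I -> in_tint t J.
Proof.
case: I J => [a [b|]] [c [d|]]; rewrite /tint_sub /in_tint /= ?andbT ?andbF //;
  lia.
Qed.

Lemma in_tint_lb I : tint_wf I -> in_tint I.1 I.
Proof. by rewrite /in_tint leqnn. Qed.

Lemma mem_in_tints I t s : I \in s -> in_tint t I -> in_tints t s.
Proof. by move=> sI tI; apply/hasP; exists I. Qed.

(** * Safe intervals, arrival intervals and successors *)

Section Nodes.

Variables (R : realType) (V : eqType) (P : instance R V).
Variable proj : node V -> edge V -> seq tint.
Hypotheses (P_valid : valid_instance P) (proj_correct : projection_spec P proj).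

(** If the run passed the last time [d] of [J], then [d.+1] would lie in another safe interval, and
    separation would need an unsafe time strictly between [d] and [d.+1]. *)
Lemma safe_run_in_one_interval v J a b :
  J \in SIv P v -> in_tint a J -> a <= b ->
  (forall x, a <= x <= b -> in_tints x (SIv P v)) -> in_tint b J.
Proof.
case: J => c [d|] Jv; rewrite /in_tint /= ?andbT; last by lia.
case/andP=> ca ad ab safe; rewrite (leq_trans ca ab) /=.
rewrite leqNgt; apply/negP=> db.
have /hasP[K Kv dK] : in_tints d.+1 (SIv P v) by apply: safe; lia.
have dJ : in_tint d (c, Some d) by rewrite /in_tint /= leqnn; lia.
(* Separation is stated for positions; these differ because [d.+1] lies in [K] but not in [J]. *)
have neqJK : index (c, Some d) (SIv P v) != index K (SIv P v).
  apply/eqP=> /(congr1 (nth (0, None) (SIv P v))); rewrite !nth_index // => eJK.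
  by move: dK; rewrite -eJK /in_tint /= ltnn andbF.
have := SIv_separated P_valid (v := v).
move=> /(_ (index (c, Some d) (SIv P v)) (index K (SIv P v))).
rewrite !index_mem !nth_index // => /(_ Jv Kv neqJK) [t [_ [|]]] /(_ _ _ dJ dK);
  lia.
Qed.

Lemma arrival_lb v I : (arrival_tint P v I).1 = I.1.
Proof. by rewrite /arrival_tint /extend_ub; case: ifP. Qed.

Lemma extend_ubP v I J : J \in SIv P v -> tint_sub I J ->
  exists2 K, K \in SIv P v & tint_sub I K /\ extend_ub P v I = (I.1, K.2).
Proof.
move=> Jv IJ; have hasI : has (tint_sub I) (SIv P v) by apply/hasP; exists J.
exists (nth I (SIv P v) (find (tint_sub I) (SIv P v))); last first.
  by split=> //; apply: nth_find.
by apply: mem_nth; rewrite -has_find.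
Qed.

Lemma arrival_is_node v I J : tint_wf I -> J \in SIv P v -> tint_sub I J ->
  is_node P (v, arrival_tint P v I).
Proof.
move=> wfI Jv IJ; rewrite /arrival_tint; case: ifP => _; last by split=> //; exists J.
have [K Kv [IK ->]] := extend_ubP Jv IJ; split=> /=.
  by move: wfI IK; case: I K {IJ Kv} => [a [b|]] [c [d|]];
     rewrite /tint_wf /tint_sub /= ?andbF //; lia.
exists K => //; move: IK; case: I K {IJ Kv wfI} => [a [b|]] [c [d|]];
  rewrite /tint_sub /= ?andbF ?andbT ?leqnn ?andbT //; lia.
Qed.

(** At nonzero velocity no wait is possible, so [b = a]. At velocity 0 the safe run from [a] to [b]
    cannot leave the safe interval whose upper bound replaces that of [I]. *)
Lemma in_arrival v I J a b : J \in SIv P v -> tint_sub I J -> in_tint a I ->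
    a <= b -> (a < b -> vel P v = 0%R) ->
    (a < b -> forall x, a <= x <= b -> in_tints x (SIv P v)) ->
  in_tint b (arrival_tint P v I).
Proof.
move=> Jv IJ aI ab vel0 safe; rewrite /arrival_tint; case: eqP => velP; last first.
  suff -> : b = a by [].
  by apply/eqP; rewrite eqn_leq ab leqNgt andbT; apply/negP => /vel0.
have [K Kv [IK ->]] := extend_ubP Jv IJ.
have aK := tint_sub_in IK aI.
have bK : in_tint b K.
  move: ab; rewrite leq_eqVlt => /predU1P[<- //|ltab].
  by apply: safe_run_in_one_interval Kv aK (ltnW ltab) (safe ltab).
move: aI bK; rewrite /in_tint /= => /andP[Ia _] /andP[_ ->].
by rewrite andbT; apply: leq_trans Ia ab.
Qed.

Lemma start_safe : exists2 J, J \in SIv P (vstart P) &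
  tint_sub (tstart P, Some (tstart P)) J.
Proof.
have /hasP[J Jv tJ] := tstart_safe P_valid.
by exists J => //; move: tJ; case: J {Jv} => [c [d|]].
Qed.

Lemma start_is_node : is_node P (start_node P).
Proof.
by have [J Jv tJ] := start_safe; apply: arrival_is_node Jv tJ; rewrite /tint_wf /=.
Qed.

Lemma successorsP n s e : reflect
  [/\ is_edge P e, e.1 = n.1
    & exists2 I, I \in proj n e & s = (e.2, arrival_tint P e.2 I)]
  ((s, e) \in successors P proj n).
Proof.
apply: (iffP allpairsPdep) => [[u [I [uP IP [-> ->]]]]|[eP en [I IP ->]]].
  by split=> //; exists I.
exists e.2, I; case: e eP en IP => v u /= eP <- IP; split=> //.
Qed.

Lemma successor_is_node n s e :
  is_node P n -> (s, e) \in successors P proj n -> is_node P s.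
Proof.
move=> nP /successorsP[eP en [I IP ->]].
have [wf _ safe _] := proj_correct nP eP en; have [J Jv IJ] := safe I IP.
by apply: arrival_is_node Jv IJ; apply: (allP wf).
Qed.

(** Backward step for the reconstruction. After the upper bound has been extended, only the lower
    bound is sure to be an arrival time; this is why [a] depends on the velocity. *)
Lemma successor_transition n s e t : is_node P n ->
    (s, e) \in successors P proj n -> in_tint t s.2 ->
  let a := if vel P s.1 == 0%R then node_lb s else t in
  exists d, [/\ d + dur P e = a, in_tint d n.2 & transition_free P e d].
Proof.
move=> nP /successorsP[eP en [I IP ->]] /= ts.
have [wf _ _ projE] := proj_correct nP eP en.
rewrite /node_lb /= arrival_lb; move: ts; rewrite /arrival_tint.
case: ifP => _ tI.
- have /projE [d [dn fr ->]] : in_tints I.1 (proj n e).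
    exact: mem_in_tints IP (in_tint_lb (allP wf _ IP)).
  by exists d.
- by have /projE [d [dn fr ->]] := mem_in_tints IP tI; exists d.
Qed.

(** For [t] the lower bound of [s], both cases of [successor_transition] agree: it is the arrival
    time of a move of positive duration that starts in the interval of [n]. *)
Lemma successor_lb n s e : is_node P n -> (s, e) \in successors P proj n ->
  node_lb n < node_lb s.
Proof.
move=> nP sP; have [wfs _] := successor_is_node nP sP.
have := successor_transition nP sP (in_tint_lb wfs).
rewrite -/(node_lb s) if_same => -[d [<- /andP[nd _] _]].
have [eP _ _] := successorsP _ _ _ sP; have := dur_ge1 P_valid eP.
by rewrite /node_lb; lia.
Qed.

(** Forward step for tracking a solution: it departs at [d] along [e] and, possibly after a wait,
    leaves [e.2] at [b]. *)
Lemma successor_covers n e d b : is_node P n -> is_edge P e -> e.1 = n.1 ->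
    in_tint d n.2 -> transition_free P e d -> d + dur P e <= b ->
    (d + dur P e < b -> vel P e.2 = 0%R) ->
    (d + dur P e < b -> forall x, d + dur P e <= x <= b -> in_tints x (SIv P e.2)) ->
  exists s, [/\ (s, e) \in successors P proj n, s.1 = e.2 & in_tint b s.2].
Proof.
move=> nP eP en dn fr leb vel0 safe.
have [_ _ sub projE] := proj_correct nP eP en.
have /hasP[I IP aI] : in_tints (d + dur P e) (proj n e).
  by apply/projE; exists d.
have [J Jv IJ] := sub _ IP.
exists (e.2, arrival_tint P e.2 I); split=> //; first by apply/successorsP; split=> //; exists I.
exact: in_arrival Jv IJ aI leb vel0 safe.
Qed.

(* Lower bounds increase strictly along successors, so this list contains every
   generated node whose lower bound is at most the depth. *)
Fixpoint nodes_upto (k : nat) : seq (node V) :=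
  start_node P ::
  if k is k'.+1 then flatten [seq unzip1 (successors P proj n) | n <- nodes_upto k']
  else [::].

Inductive generated : node V -> Prop :=
| GenStart : generated (start_node P)
| GenSucc n s e : generated n -> (s, e) \in successors P proj n -> generated s.

Lemma generated_is_node n : generated n -> is_node P n.
Proof.
elim=> [|m s e _ mP sP]; first exact: start_is_node.
exact: successor_is_node mP sP.
Qed.

Lemma generated_nodes_upto n k : generated n -> node_lb n <= k -> n \in nodes_upto k.
Proof.
move=> gn; elim: gn k => [|m s e gm IHm sP] k lek; first by case: k {lek} => [|k]; apply: mem_head.
have ltms := successor_lb (generated_is_node gm) sP.
case: k lek => [|k] lek /=; first by lia.
rewrite in_cons; apply/orP; right; apply/flatten_mapP; exists m.
  by apply: IHm; lia.
by apply/mapP; exists (s, e).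
Qed.

(** * Prepending a wait to a trajectory *)

Lemma feasible_wait_before v t0 t g pi : t0 <= t -> vel P v = 0%R ->
  feasible P v t g pi -> feasible P v t0 g pi.
Proof.
by move=> le0 vel0; case: pi => [|[e s] pi] //= [eP ev ts _ fpi]; split=> //; lia.
Qed.

Lemma collision_free_wait_before v t0 t g pi : t0 <= t ->
    (forall x, t0 <= x <= t -> in_tints x (SIv P v)) ->
  feasible P v t g pi -> collision_free P v t pi -> collision_free P v t0 pi.
Proof.
move=> le0 safe; case: pi => [|[e s] pi] //= [_ _ ts _ _] [safe' fr cf]; split=> //.
move=> lt0 x xP; case: (leqP x t) => xt; first by apply: safe; lia.
by apply: safe'; lia.
Qed.

Lemma node_interval_safe n x y z : is_node P n -> in_tint x n.2 -> in_tint z n.2 ->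
  x <= y <= z -> in_tints y (SIv P n.1).
Proof.
move=> [_ [J Jv nJ]] xn zn xyz; apply: mem_in_tints Jv _; apply: tint_sub_in nJ _.
by move: xn zn; rewrite /in_tint; case: n.2.2 => [b|]; lia.
Qed.

(** * The invariant of the main loop *)

Section Search.

Variable h : V -> R.
Hypotheses (h_heuristic : is_heuristic P h) (h_consistent : consistent P h).

Definition seen (st : state V) (n : node V) : bool :=
  (n \in OPEN st) || (n \in CLOSED st).

(* [T] is the finishing time of some solution. *)
Record search_inv (T : nat) (st : state V) : Prop := SearchInv {
  inv_start : seen st (start_node P);
  inv_parent : forall n, seen st n -> n != start_node P -> exists m e,
    [/\ parent st n = Some (m, e), m \in CLOSED st & (n, e) \in successors P proj m];
  inv_not_goal : forall n, n \in CLOSED st -> n.1 != vgoal P;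
  inv_closed : forall n s e, n \in CLOSED st -> (s, e) \in successors P proj n -> seen st s;
  inv_uniq : uniq (CLOSED st);
  inv_open : forall n, n \in OPEN st -> n \notin CLOSED st;
  inv_generated : forall n, seen st n -> generated n;
  inv_lb : forall n, n \in CLOSED st -> node_lb n <= T
}.

Lemma search_inv_init T : search_inv T (State [:: start_node P] [::] (fun=> None)).
Proof.
split=> //=.
- by rewrite /seen /= mem_head.
- by move=> n; rewrite /seen /= inE orbF => ->.
- by move=> n; rewrite /seen /= inE orbF => /eqP->; apply: GenStart.
Qed.

(** Summary of the insertion loop: recorded parents are never overwritten, so parent chains stay
    intact, and no closed node is reopened. *)
Lemma foldl_insertP n l st (st' := foldl (insert n) st l) :
  [/\ CLOSED st' = CLOSED st,
      forall x, seen st x -> seen st' x /\ parent st' x = parent st x,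
      forall s e, (s, e) \in l -> seen st' s,
      forall x, seen st' x -> ~~ seen st x ->
        exists2 e, (x, e) \in l & parent st' x = Some (n, e)
    & forall x, x \in OPEN st' -> x \in OPEN st \/ x \notin CLOSED st].
Proof.
rewrite {}/st'; elim: l st => [|[s e] l IHl] st /=.
  by split=> // [x ->|x]; [|left].
have [C1 S1 L1 N1 O1] := IHl (insert n st (s, e)).
have C2 : CLOSED (insert n st (s, e)) = CLOSED st by rewrite /insert; case: ifP.
have S2 x : seen st x ->
    seen (insert n st (s, e)) x /\ parent (insert n st (s, e)) x = parent st x.
  rewrite /insert; case: ifP => // /negbT nsees seex; split.
    by move: seex; rewrite /seen /= inE => /orP[->|->]; rewrite !orbT.
  by rewrite /=; case: eqP => // xs; move: seex nsees; rewrite /seen xs /= => ->.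
have S3 : seen (insert n st (s, e)) s.
  by rewrite /insert; case: ifP => // _; rewrite /seen /= mem_head.
split=> [|x /S2[/S1[-> ->] ->] //|t d||].
- by rewrite C1.
- by rewrite in_cons => /predU1P[[-> _]|/L1 //]; have [] := S1 s S3.
- move=> x seex nseex; case seex1: (seen (insert n st (s, e)) x); last first.
    have [d dl parx] := N1 x seex (negbT seex1).
    by exists d => //; rewrite in_cons dl orbT.
  have [_ ->] := S1 _ seex1; exists e; last first.
    move: seex1 nseex; rewrite /insert; case: ifP => [_ -> //|_].
    by rewrite /seen /= inE; case: eqP => //= _ ->.
  suff -> : x = s by rewrite mem_head.
  move: seex1 nseex; rewrite /insert; case: ifP => [_ -> //|_].
  by rewrite /seen /= inE; case: eqP => //= _ ->.
- move=> x /O1; rewrite C2 /insert; case: ifP => [_ //|/norP[_ sC]] /=.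
  by rewrite inE => -[/predU1P[->|]|]; [right|left|right].
Qed.

Lemma search_inv_expand T st n : search_inv T st -> n \in OPEN st ->
    n.1 != vgoal P -> node_lb n <= T ->
  search_inv T (expand P proj n st).
Proof.
move=> inv nO ngoal leT; rewrite /expand.
have [C1 S1 L1 N1 O1] := foldl_insertP n (successors P proj n) (close n st).
set st' := foldl _ _ _ in C1 S1 L1 N1 O1 *.
(* Closing only moves [n] from OPEN to CLOSED. *)
have seenE x : seen (close n st) x = seen st x.
  rewrite /seen /= mem_filter inE; case: eqP => [->|_] //=.
  by rewrite nO.
have sn : seen st n by rewrite /seen nO.
have new x : seen st' x -> ~~ seen st x ->
    exists2 e, (x, e) \in successors P proj n & parent st' x = Some (n, e).
  by move=> sx; rewrite -seenE; apply: N1.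
split.
- by apply: (S1 _ _).1; rewrite seenE; apply: inv_start inv.
- move=> x sx xs; rewrite C1 /=; case sx0: (seen st x).
    have [m [e [parx mC mP]]] := inv_parent inv sx0 xs.
    exists m, e; rewrite inE mC orbT; split=> //.
    by rewrite -parx; apply: (S1 _ _).2; rewrite seenE.
  by have [e eP parx] := new x sx (negbT sx0); exists n, e; rewrite mem_head.
- by move=> x; rewrite C1 inE => /predU1P[-> //|]; apply: inv_not_goal inv _.
- move=> m s e; rewrite C1 inE => /predU1P[-> /L1 //|mC sP].
  by apply: (S1 _ _).1; rewrite seenE; exact: (inv_closed inv mC sP).
- by rewrite C1 /= (inv_open inv nO) (inv_uniq inv).
- move=> x xO; rewrite C1; case: (O1 x xO) => //=.
  by rewrite mem_filter inE => /andP[/negPf-> /(inv_open inv)].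
- move=> x sx; case sx0: (seen st x); first exact: inv_generated inv _ sx0.
  have [e eP _] := new x sx (negbT sx0).
  exact: GenSucc (inv_generated inv sn) eP.
- by move=> x; rewrite C1 inE => /predU1P[-> //|]; apply: inv_lb inv _.
Qed.

(** * Reconstruction: existence and soundness *)

(** Lower bounds decrease strictly towards the parent, so the walk ends; each new time lies in the
    parent's interval, so the walk can continue. *)
Lemma reconstruct_exists T st n t : search_inv T st -> seen st n -> in_tint t n.2 ->
  forall pi, exists pi', reconstruct P (parent st) n t pi pi'.
Proof.
move=> inv; have [k] := ubnP (node_lb n); elim: k n t => // k IHk n t ltk sn tn pi.
have [->|ns] := eqVneq n (start_node P); first by exists pi; apply: RecStop.
have [m [e [parn mC sP]]] := inv_parent inv sn ns.
have sm : seen st m by rewrite /seen mC orbT.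
have mP := generated_is_node (inv_generated inv sm).
have [s [sE sm2 _]] := successor_transition mP sP tn.
have ltmn := successor_lb mP sP.
have [|pi' recm] := IHk m s _ sm sm2 ((e, s) :: pi); first by lia.
by exists pi'; apply: RecStep ns parn sE recm.
Qed.

(** Induction on the reconstruction, for an arbitrary suffix [pi] that is already correct from [n]
    at time [t]. *)
Lemma reconstruct_sound T st n t pi pi' : search_inv T st ->
    reconstruct P (parent st) n t pi pi' -> seen st n -> in_tint t n.2 ->
    feasible P n.1 t (vgoal P) pi -> collision_free P n.1 t pi ->
  solution P pi'.
Proof.
move=> inv; elim=> {n t pi pi'} [t pi|n t pi pi' m e s ns parn sE _ IH] sn tn fpi cpi.
  have stP := start_is_node; rewrite /solution.
  (* At nonzero velocity the start interval is the single time [tstart P]. *)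
  have [ts|ts] : t = tstart P \/ (tstart P < t /\ vel P (vstart P) = 0%R).
  - move: tn; rewrite /= /arrival_tint; case: eqP => velP.
      rewrite /in_tint /= => /andP[]; rewrite leq_eqVlt => /predU1P[<-|]; auto.
    by rewrite /in_tint /= -eqn_leq => /eqP; left.
  - by rewrite -ts.
  have [lts vel0] := ts; split.
    exact: feasible_wait_before (ltnW lts) vel0 fpi.
  apply: collision_free_wait_before (ltnW lts) _ fpi cpi => x.
  apply: (node_interval_safe stP) tn.
  have [wf _] := stP; have := in_tint_lb wf.
  by rewrite {1}/start_node /= arrival_lb.
have [m' [e' [parn' mC sP]]] := inv_parent inv sn ns.
move: parn'; rewrite parn => -[mm ee]; subst m' e'.
have sm : seen st m by rewrite /seen mC orbT.
have mP := generated_is_node (inv_generated inv sm).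
have nP := generated_is_node (inv_generated inv sn).
have [s' [sE' sm2 fr]] := successor_transition mP sP tn.
(* Both times plus the duration of [e] give the same arrival time. *)
have ss : s' = s by move: sE'; rewrite -sE => /addIn.
subst s'.
have [eP em [I _ nE]] := successorsP _ _ _ sP.
have ne : e.2 = n.1 by rewrite nE.
(* The move may arrive before [t]: at velocity 0 it arrives at the lower bound of [n], and the agent
   waits inside the node's interval. *)
suff [fn cn] : feasible P e.2 (s + dur P e) (vgoal P) pi /\
               collision_free P e.2 (s + dur P e) pi.
  by apply: IH => //=; split=> //; rewrite ltnn.
rewrite sE ne; case: eqP => velP; last by [].
have lbt : node_lb n <= t by move: tn; rewrite /in_tint => /andP[].
split; first exact: feasible_wait_before lbt velP fpi.
apply: collision_free_wait_before lbt _ fpi cpi => x.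
by apply: (node_interval_safe nP) tn; apply: in_tint_lb; case: nP.
Qed.

(** * Tracking a solution through the search *)

Definition departure (t : nat) (pi : trajectory V) : nat :=
  if pi is (_, s) :: _ then s else t.

Fixpoint finish (t : nat) (pi : trajectory V) : nat :=
  if pi is (e, s) :: pi' then finish (s + dur P e) pi' else t.

Lemma feasible_departure v t g pi : feasible P v t g pi -> t <= departure t pi.
Proof. by case: pi => [|[e s] pi] //= []. Qed.

(** Consistency telescopes along the remaining moves down to [h] at the goal, which is 0. *)
Lemma heuristic_le_finish v t pi : feasible P v t (vgoal P) pi ->
  ((departure t pi)%:R + h v <= (finish t pi)%:R)%R.
Proof.
elim: pi v t => [|[e s] pi IHpi] v t /=.
  by move=> ->; have [_ ->] := h_heuristic; rewrite addr0.
case=> eP <- _ _ fpi; apply: le_trans (IHpi _ _ fpi).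
have := feasible_departure fpi; rewrite -(ler_nat R) natrD => le_dep.
by have := h_consistent eP; lra.
Qed.

(** Induction on the remaining trajectory. An open node containing the departure time is the
    witness; a closed one is not at the goal, and one of its successors, already seen, contains the
    next departure time. *)
Lemma open_node_below_finish T st n t pi : search_inv T st ->
    feasible P n.1 t (vgoal P) pi -> collision_free P n.1 t pi ->
    seen st n -> in_tint (departure t pi) n.2 ->
  exists2 m, m \in OPEN st & (fvalue h m <= (finish t pi)%:R)%R.
Proof.
move=> inv; elim: pi n t => [|[e s] pi IHpi] n t fpi cpi sn dn.
all: case/orP: (sn) => [nO|nC].
1,3: exists n => //; apply: le_trans (heuristic_le_finish fpi);
  by rewrite /fvalue lerD2r ler_nat; case/andP: dn.
- by move: fpi (inv_not_goal inv nC) => /= ->; rewrite eqxx.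
have nP := generated_is_node (inv_generated inv sn).
case: fpi cpi => eP en _ _ fpi [_ fr cpi].
have [||s' [sP s'e ds']] := @successor_covers n e s (departure (s + dur P e) pi)
  nP eP en dn fr (feasible_departure fpi).
- by case: pi fpi {cpi IHpi dn} => [|[e' s'] pi] /=; [rewrite ltnn|case].
- by case: pi cpi {fpi IHpi dn} => [|[e' s'] pi] /=; [rewrite ltnn|case].
apply: (IHpi s' (s + dur P e)); rewrite ?s'e //.
exact: (inv_closed inv nC sP).
Qed.

Lemma extractable_exists st n : n \in OPEN st -> exists m, extractable h st m.
Proof.
rewrite /extractable; elim: (OPEN st) n => //= a l IHl _ _.
have [->|[b /IHl [m /andP[ml mmin]]]] : l = [::] \/ exists b, b \in l.
- by case: (l) => [|b l']; [left|right; exists b; rewrite mem_head].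
- by exists a; rewrite mem_head /= lexx.
have [leam|ltma] := leP (fvalue h a) (fvalue h m).
  exists a; rewrite mem_head /= lexx /=.
  by apply/allP => x /(allP mmin); apply: le_trans.
by exists m; rewrite in_cons ml orbT /= (ltW ltma).
Qed.

(** * Correct result and termination when a solution exists *)

Section Solvable.

Variable sol : trajectory V.
Hypothesis sol_solution : solution P sol.

Let T := finish (tstart P) sol.

Lemma start_covers : in_tint (departure (tstart P) sol) (start_node P).2.
Proof.
have [fsol csol] := sol_solution; have [J Jv tJ] := start_safe.
apply: in_arrival Jv tJ _ (feasible_departure fsol) _ _.
- by rewrite /in_tint /= leqnn.
- by case: (sol) fsol => [|[e s] pi] /=; [rewrite ltnn|case].
- by case: (sol) csol => [|[e s] pi] /=; [rewrite ltnn|case].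
Qed.

Lemma open_node_below_solution st : search_inv T st ->
  exists2 m, m \in OPEN st & (fvalue h m <= T%:R)%R.
Proof.
move=> inv; have [fsol csol] := sol_solution.
exact: (@open_node_below_finish _ _ (start_node P) _ _ inv fsol csol (inv_start inv)
  start_covers).
Qed.

(** The minimal [f]-value is at most [T], and [h] is nonnegative. *)
Lemma extractable_lb st n : search_inv T st -> extractable h st n -> node_lb n <= T.
Proof.
move=> /open_node_below_solution [m mO mT] /andP[_ /allP/(_ m mO) nm].
rewrite -(ler_nat R); have [h0 _] := h_heuristic; have := h0 n.1.
by move: nm mT; rewrite /fvalue; lra.
Qed.

Definition config_inv (c : config V) : Prop :=
  match c with
  | Running st => search_inv T st
  | Returned pi => solution P pi
  | Failed => False
  end.

Lemma config_inv_step c c' : step P h proj c c' -> config_inv c -> config_inv c'.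
Proof.
case=> [st O0|st n pi nx ngoal recn|st n nx ngoal] inv.
- by have [m] := open_node_below_solution inv; rewrite O0.
- have sn : seen st n by rewrite /seen; case/andP: nx => ->.
  have [wf _] := generated_is_node (inv_generated inv sn).
  exact: reconstruct_sound inv recn sn (in_tint_lb wf) ngoal I.
- have nO : n \in OPEN st by case/andP: nx.
  exact: search_inv_expand inv nO ngoal (extractable_lb inv nx).
Qed.

Lemma running_can_step st : search_inv T st -> exists c, step P h proj (Running st) c.
Proof.
move=> inv; have [m mO _] := open_node_below_solution inv.
have [n nx] := extractable_exists mO.
have [ngoal|ngoal] := eqVneq n.1 (vgoal P); last by eexists; apply: StepExpand nx ngoal.
have sn : seen st n by rewrite /seen; case/andP: nx => ->.
have [wf _] := generated_is_node (inv_generated inv sn).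
have [pi recn] := reconstruct_exists inv sn (in_tint_lb wf) [::].
by exists (Returned pi); apply: StepGoal nx ngoal recn.
Qed.

Lemma final_config_solution c : final_config P h proj c ->
  exists pi, c = Returned pi /\ solution P pi.
Proof.
case=> run stuck.
have : config_inv c.
  elim: run (search_inv_init T : config_inv (init P)) {stuck} => // x y z xy _ IH invx.
  exact: IH (config_inv_step xy invx).
case: c stuck {run} => [st|pi|] //= stuck inv; last by exists pi.
by have [c' /stuck] := running_can_step inv.
Qed.

(** Each iteration closes one new node, while all closed nodes are distinct members of the finite
    list [nodes_upto T]. *)
Lemma no_infinite_run : ~ exists r, infinite_run P h proj r.
Proof.
case=> r [r0 rstep].
have run k : exists st, [/\ r k = Running st, search_inv T st & size (CLOSED st) = k].
  elim: k => [|k [st [rk inv szk]]].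
    by eexists; split; [exact: r0|exact: search_inv_init|].
  have := config_inv_step (rstep k); rewrite rk => /(_ inv) inv'.
  move: (rstep k) (rstep k.+1) inv'; rewrite rk => skk.
  (* [Failed] and [Returned] admit no further step, so only an expansion can be followed by
     [rstep k.+1]. *)
  inversion skk; subst; [by move=> s; inversion s|by move=> s; inversion s|].
  move=> _ inv'; eexists; split; [by []|exact: inv'|].
  rewrite /expand; set l := successors _ _ _.
  by have [-> _ _ _ _] := foldl_insertP n l (close n st).
have [st [_ inv szC]] := run (size (nodes_upto T)).+1.
suff : size (CLOSED st) <= size (nodes_upto T) by rewrite szC ltnn.
apply: uniq_leq_size (inv_uniq inv) _ => n nC.
apply: generated_nodes_upto (inv_lb inv nC); apply: inv_generated inv _ _.
by rewrite /seen nC orbT.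
Qed.

End Solvable.
End Search.
End Nodes.

Theorem theorem1 (R : realType) (V : eqType) (P : instance R V) (h : V -> R)
    (proj : node V -> edge V -> seq tint)
    (P_valid : valid_instance P)
    (h_heuristic : is_heuristic P h)
    (h_admissible : admissible P h)
    (h_consistent : consistent P h)
    (proj_correct : projection_spec P proj)
    (solvable : exists pi, solution P pi) :
  (~ exists r, infinite_run P h proj r) /\
  (forall c, final_config P h proj c ->
     exists pi, c = Returned pi /\ solution P pi).
Proof.
have [sol solP] := solvable; split.
  exact: (no_infinite_run P_valid proj_correct h_heuristic h_consistent solP).
move=> c.
exact: (final_config_solution P_valid proj_correct h_heuristic h_consistent solP).
Qed.
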